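(* Let $n,r,m\ge 0$ be integers, and for an integer $\ell\geq 0$ put $N_r=N_r(\ell)=\min\{n+r+1,\;m+r-\ell\}$. Then, as polynomials in $x,y$: (1) for every integer $\ell$ with $0\le \ell\le m$, $$\sum_{k=0}^{N_r(\ell)}\det\begin{pmatrix} M_{n,k}(x,y) & M_{m,k+\ell+1}(x,y)\\ M_{n+r+1,k}(x,y) & M_{m+r+1,k+\ell+1}(x,y)\end{pmatrix}=\sum_{i=0}^{r} M_{n+i,0}(x,y)\,M_{m+r-i,\ell}(y,y);$$ (2) $$\sum_{\ell=0}^{m+r}\ \sum_{k=0}^{N_r(\ell)}\det\begin{pmatrix} M_{n,k}(x,y) & M_{m,k+\ell+1}(x,y)\\ M_{n+r+1,k}(x,y) & M_{m+r+1,k+\ell+1}(x,y)\end{pmatrix}=\sum_{i=0}^{r} M_{n+i,0}(x,y)\,M_{m+r-i,0}(y+1,y).$$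
   Context: A partial Motzkin path from $(0,0)$ to $(n,k)$ is a lattice path that never goes below the $X$-axis and consists of up steps $U=(1,1)$, down steps $D=(1,-1)$ and horizontal steps $H=(1,0)$. In a weighted partial Motzkin path, every up step and every down step has weight $1$, every horizontal step lying on the $X$-axis has weight $x$, and every horizontal step not lying on the $X$-axis has weight $y$; the weight of a path is the product of the weights of its steps. $M_{n,k}(x,y)$ is the sum of the weights of all partial Motzkin paths from $(0,0)$ to $(n,k)$. Equivalently, $M_{0,0}(x,y)=1$, $M_{n,k}(x,y)=0$ if $n<k$ or $k<0$, $M_{n,0}(x,y)=xM_{n-1,0}(x,y)+M_{n-1,1}(x,y)$ for $n\ge1$, and $M_{n,k}(x,y)=M_{n-1,k-1}(x,y)+yM_{n-1,k}(x,y)+M_{n-1,k+1}(x,y)$ for $n\ge k\ge 1$. $M_{n,k}(y,y)$ and $M_{n,k}(y+1,y)$ denote the polynomials obtained by substituting $x=y$ and $x=y+1$, respectively. *)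

(* Defs.v *)
From HB Require Import structures.
From mathcomp Require Import all_boot all_order all_algebra.
From mathcomp Require Import mpoly.

Set Implicit Arguments.
Unset Strict Implicit.
Unset Printing Implicit Defensive.

Import Order.TTheory GRing.Theory Num.Theory.

Local Open Scope ring_scope.

Variant step := Up | Down | Horizontal.

Definition step_code (s : step) : option bool :=
  match s with Up => Some true | Down => Some false | Horizontal => None end.

Definition step_decode (c : option bool) : step :=
  match c with
  | Some true => Up | Some false => Down | None => Horizontal
  end.

Lemma step_codeK : cancel step_code step_decode.
Proof. by case. Qed.

HB.instance Definition _ := Finite.copy step (can_type step_codeK).

Definition rise (s : step) : int :=
  match s with Up => 1 | Down => -1 | Horizontal => 0 end.

(* A lattice path starting at (0,0) is the sequence p of its steps; each step
   advances the abscissa by 1, so the path visits the points (i, height p i)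
   for i <= size p. *)
Definition height (p : seq step) (i : nat) : int :=
  \sum_(s <- take i p) rise s.

Definition partial_motzkin (n k : nat) (p : n.-tuple step) : bool :=
  [forall i : 'I_n.+1, 0 <= height p i] && (height p n == k%:Z).

Notation X := ('X_0 : {mpoly int[2]}).
Notation Y := ('X_1 : {mpoly int[2]}).

(* h is the ordinate of the starting point of the step s. *)
Definition step_weight (h : int) (s : step) : {mpoly int[2]} :=
  match s with
  | Up | Down => 1
  | Horizontal => if h == 0 then X else Y
  end.

Definition path_weight (n : nat) (p : n.-tuple step) : {mpoly int[2]} :=
  \prod_(i < n) step_weight (height p i) (tnth p i).

Definition M (n k : nat) : {mpoly int[2]} :=
  \sum_(p : n.-tuple step | partial_motzkin k p) path_weight p.

(* The substitution x := a, y := b in M n k. *)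
Definition Msubst (n k : nat) (a b : {mpoly int[2]}) : {mpoly int[2]} :=
  M n k \mPo [tuple a; b].

Definition mx22 (R : Type) (a b c d : R) : 'M[R]_2 :=
  \matrix_(i < 2, j < 2)
    if i == 0 then (if j == 0 then a else b) else (if j == 0 then c else d).

(* The subtraction does not truncate in the range l <= m + r where the bound
   is used. *)
Definition N (n m r l : nat) : nat := minn (n + r + 1) (m + r - l).

(* Main.v *)
(** Splitting a path at its last step gives the recurrence of the weights. With
    [S a b = \sum_k M a k * M b (k + l + 1)], the recurrence makes
    [S a b.+1 - S a.+1 b] collapse to the boundary contribution
    [M a 0 * (M b l + (y - x) * M b l.+1)], and the second factor is [M b l]
    at [x := y]. Part (1) is the telescoping of these differences along
    [(a, b) = (n + i, m + r - i)]. For [x := y + 1] the same formula reads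
    [M b l (y, y) = M b l (y + 1, y) - M b l.+1 (y + 1, y)], which telescopes in
    [l] and yields part (2). *)
Require Import Defs.
From mathcomp Require Import all_boot all_order all_algebra.
From mathcomp Require Import mpoly.
From mathcomp Require Import ring zify.

Set Implicit Arguments.
Unset Strict Implicit.
Unset Printing Implicit Defensive.

Import Order.TTheory GRing.Theory Num.Theory.

Local Open Scope ring_scope.

(** The recurrence with [x] and [y] as arguments in an arbitrary ring, so that the specialisations
    at [(Y, Y)] and [(Y + 1, Y)] are instances of the same function. *)
Fixpoint motzkin (R : comNzRingType) (x y : R) (n k : nat) : R :=
  match n with
  | 0 => (k == 0)%:R
  | n'.+1 =>
      (if k is k'.+1 then motzkin x y n' k' + y * motzkin x y n' k
       else x * motzkin x y n' 0) + motzkin x y n' k.+1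
  end.

Lemma motzkin_small (R : comNzRingType) (x y : R) n k :
  (n < k)%N -> motzkin x y n k = 0.
Proof.
elim: n k => [|n IHn] [|k] //= lt_nk.
by rewrite !IHn ?mulr0 ?addr0 //; lia.
Qed.

Lemma rmorph_motzkin (R S : comNzRingType) (f : {rmorphism R -> S}) x y n k :
  f (motzkin x y n k) = motzkin (f x) (f y) n k.
Proof.
elim: n k => [|n IHn] [|k] /=; rewrite ?rmorph1 ?rmorph0 //.
  by rewrite rmorphD rmorphM !IHn.
by rewrite !rmorphD rmorphM !IHn.
Qed.

(** Both sides obey the same recurrence in [n]. At [k = 0], the up-step term
    [(y - x) * motzkin x y n 0] inside [motzkin x y n.+1 1] turns the axis weight [x] into [y]. *)
Lemma motzkin_diag (R : comNzRingType) (x y : R) n k :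
  motzkin y y n k = motzkin x y n k + (y - x) * motzkin x y n k.+1.
Proof.
elim: n k => [|n IHn] [|k] /=; rewrite ?IHn; ring.
Qed.

Lemma sum_motzkin_diag (R : comNzRingType) (y : R) n K :
  (n < K)%N ->
  \sum_(0 <= l < K) motzkin y y n l = motzkin (y + 1) y n 0.
Proof.
(* At [x = y + 1] the coefficient [y - x] is [-1]; the signs fit the shape of [telescope_sumr]. *)
move=> lt_nK; rewrite (eq_bigr (fun l =>
  - motzkin (y + 1) y n l.+1 - - motzkin (y + 1) y n l)); last first.
  by move=> l _; rewrite (motzkin_diag (y + 1)); ring.
by rewrite telescope_sumr // motzkin_small // oppr0 add0r opprK.
Qed.

(** After expansion by the recurrence, the [y]-terms cancel for [k > 0] and the others cancel
    between consecutive [k]. The bottom end gives the diagonal term; the cut at [K] leaves the other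
    two. *)
Lemma sum_motzkin_step (R : comNzRingType) (x y : R) a b l K :
  \sum_(0 <= k < K.+1)
     (motzkin x y a k * motzkin x y b.+1 (k + l).+1
      - motzkin x y a.+1 k * motzkin x y b (k + l).+1)
  = motzkin x y a 0 * motzkin y y b l
    + motzkin x y a K * motzkin x y b (K + l).+2
    - motzkin x y a K.+1 * motzkin x y b (K + l).+1.
Proof.
elim: K => [|K IHK].
  by rewrite big_nat1 (motzkin_diag x) /= add0n; ring.
by rewrite big_nat_recr //= IHK addSn; ring.
Qed.

(** Each alternative of the hypothesis kills both terms at the cut [K], for all [i <= r]: the first
    through the factor of length [n + i], the second through that of length [m + r - i]. *)
Lemma sum_motzkin_det (R : comNzRingType) (x y : R) n r m l K :
  (n + r < K)%N || (m + r <= K + l)%N ->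
  \sum_(0 <= k < K.+1)
     (motzkin x y n k * motzkin x y (m + r + 1) (k + l + 1)
      - motzkin x y (n + r + 1) k * motzkin x y m (k + l + 1))
  = \sum_(0 <= i < r.+1) motzkin x y (n + i) 0 * motzkin y y (m + r - i) l.
Proof.
move=> leK.
(* The values at [i = r.+1] and [i = 0] are, up to sign, the two products in the determinant. *)
pose t k i := - (motzkin x y (n + i) k * motzkin x y (m + r + 1 - i) (k + l + 1)).
transitivity (\sum_(0 <= k < K.+1) \sum_(0 <= i < r.+1) (t k i.+1 - t k i)).
  apply: eq_bigr => k _; rewrite telescope_sumr // /t subn0 addn0.
  rewrite (_ : m + r + 1 - r.+1 = m)%N; last by lia.
  by rewrite -[r.+1]addn1 addnA; ring.
rewrite exchange_big_nat /=; apply: eq_big_nat => i /andP[_ lt_ir].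
rewrite (eq_bigr (fun k =>
  motzkin x y (n + i) k * motzkin x y (m + r - i).+1 (k + l).+1
  - motzkin x y (n + i).+1 k * motzkin x y (m + r - i) (k + l).+1)).
  rewrite sum_motzkin_step.
  case/orP: leK => leK.
    have small k : (K <= k)%N -> motzkin x y (n + i) k = 0.
      by move=> le_Kk; apply: motzkin_small; lia.
    by rewrite (small K) ?(small K.+1) // !mul0r addr0 subr0.
  have small k : (K + l < k)%N -> motzkin x y (m + r - i) k = 0.
    by move=> lt_Kk; apply: motzkin_small; lia.
  by rewrite (small (K + l).+2) ?(small (K + l).+1) // !mulr0 addr0 subr0.
move=> k _; rewrite /t opprK addnS !addn1 subSS subSn; last by lia.
ring.
Qed.

Definition nonneg_path n (p : n.-tuple step) : bool :=
  [forall i : 'I_n.+1, 0 <= height p i].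

(* Indexing by an integer end height makes the recurrence uniform, the value at
   -1 being 0. *)
Definition path_sum n (h : int) : {mpoly int[2]} :=
  \sum_(p : n.-tuple step | nonneg_path p && (height p n == h)) path_weight p.

Lemma height_rcons p s i : (i <= size p)%N -> height (rcons p s) i = height p i.
Proof.
by move=> le_ip; rewrite /height -cats1 takel_cat.
Qed.

Lemma height_rcons_last p s :
  height (rcons p s) (size p).+1 = height p (size p) + rise s.
Proof.
by rewrite /height take_oversize ?size_rcons // take_size -cats1 big_cat big_seq1.
Qed.

Lemma nonneg_path_rcons n (p : n.-tuple step) s :
  nonneg_path [tuple of rcons p s]
  = nonneg_path p && (0 <= height p n + rise s).
Proof.
have hE := height_rcons_last p s; rewrite size_tuple in hE.
apply/forallP/andP => [pos | [/forallP pos last_ge0] i].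
  split; last by have := pos ord_max; rewrite /= hE.
  apply/forallP => i; have := pos (widen_ord (leqnSn _) i).
  by rewrite /= height_rcons // size_tuple -ltnS.
have [lt_in | ge_in] := ltnP i n.+1.
  by rewrite height_rcons ?size_tuple //; apply: (pos (Ordinal lt_in)).
have -> : i = n.+1 :> nat by apply/eqP; rewrite eqn_leq ge_in -ltnS ltn_ord.
by rewrite hE.
Qed.

Lemma path_weight_rcons n (p : n.-tuple step) s :
  path_weight [tuple of rcons p s] = path_weight p * step_weight (height p n) s.
Proof.
rewrite /path_weight big_ord_recr /=; congr (_ * _).
  apply: eq_bigr => i _; rewrite height_rcons ?size_tuple 1?ltnW //.
  by rewrite !(tnth_nth s) /= nth_rcons size_tuple ltn_ord.
by rewrite height_rcons ?size_tuple // (tnth_nth s) /= nth_rcons size_tuple ltnn eqxx.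
Qed.

Lemma big_step (V : nmodType) (F : step -> V) :
  \sum_s F s = F Up + F Horizontal + F Down.
Proof.
rewrite (bigD1 Up) //= (bigD1 Horizontal) //= (bigD1 Down) //= big1 ?addr0 ?addrA //.
by case.
Qed.

Lemma big_tuple_rcons (V : nmodType) (T : finType) n (P : pred (n.+1.-tuple T))
    (F : n.+1.-tuple T -> V) :
  \sum_(p | P p) F p
  = \sum_s \sum_(p : n.-tuple T | P [tuple of rcons p s]) F [tuple of rcons p s].
Proof.
rewrite pair_big_dep /=.
rewrite (reindex (fun u : T * n.-tuple T => [tuple of rcons u.2 u.1])) //=.
(* The inverse splits off the last entry; [last] and [belast] take the head of the tuple
   separately. *)
exists (fun t => (last (thead t) (behead t),
                  [tuple of belast (thead t) [tuple of behead t]])).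
  move=> [s p] _ /=; congr (_, _); last apply: val_inj => /=.
    by rewrite /thead (tnth_nth s) /=; case: p => -[|x p] //= _; rewrite last_rcons.
  by rewrite /thead (tnth_nth s) /=; case: p => -[|x p] //= _; rewrite belast_rcons.
move=> t _; apply: val_inj => /=.
by rewrite -lastI; case/tupleP: t => x t /=; rewrite theadE.
Qed.

Lemma path_sum0 h : path_sum 0 h = (h == 0)%:R.
Proof.
have pos (p : 0.-tuple step) : nonneg_path p.
  by apply/forallP => i; rewrite tuple0 /height big_nil lexx.
rewrite /path_sum (eq_bigl (fun=> h == 0)) => [|p]; last first.
  by rewrite pos tuple0 /height big_nil eq_sym.
case: eqP => _; last by rewrite big_pred0.
rewrite (big_pred1 [tuple]) => [|p]; last by rewrite /= [p]tuple0; apply/esym/eqP.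
by rewrite /path_weight big_ord0.
Qed.

Lemma path_sum_lt0 n h : h < 0 -> path_sum n h = 0.
Proof.
move=> h_lt0; rewrite /path_sum big1 // => p /andP[/forallP/(_ ord_max) /= pos].
by move=> /eqP hE; move: pos; rewrite hE leNgt h_lt0.
Qed.

Lemma path_sumS n h : 0 <= h ->
  path_sum n.+1 h = path_sum n (h - 1)
    + (if h == 0 then X else Y) * path_sum n h + path_sum n (h + 1).
Proof.
move=> h_ge0; rewrite {1}/path_sum big_tuple_rcons.
(* A last step [s] reaching [h] starts at [h - rise s], which fixes its weight; the new endpoint is
   admissible because [0 <= h]. *)
have stepE s : \sum_(p : n.-tuple step | nonneg_path [tuple of rcons p s]
                     && (height [tuple of rcons p s] n.+1 == h))
                 path_weight [tuple of rcons p s]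
    = step_weight (h - rise s) s * path_sum n (h - rise s).
  have hE (p : n.-tuple step) : height (rcons p s) n.+1 = height p n + rise s.
    by have := height_rcons_last p s; rewrite size_tuple.
  rewrite /path_sum mulr_sumr; apply: eq_big => p.
    rewrite nonneg_path_rcons /= hE -andbA [in RHS]eq_sym subr_eq [in RHS]eq_sym.
    by case: (_ =P h) => [->|_]; rewrite ?h_ge0 ?andbF.
  rewrite /= hE => /andP[_ /eqP <-].
  by rewrite path_weight_rcons addrK mulrC.
by rewrite big_step !stepE /= !mul1r subr0 opprK.
Qed.

Lemma M_motzkin n k : M n k = motzkin X Y n k.
Proof.
rewrite -[LHS]/(path_sum n k%:Z).
elim: n k => [|n IHn] k; first by rewrite path_sum0.
rewrite path_sumS // (_ : k%:Z + 1 = k.+1%:Z) ?IHn; last by lia.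
(* On the axis the up-step term is the value at height [-1], which is 0. *)
case: k => [|k] /=; first by rewrite path_sum_lt0 // add0r.
by rewrite (_ : k.+1%:Z - 1 = k%:Z) ?IHn //; lia.
Qed.

Lemma Msubst_motzkin n k a b : Msubst n k a b = motzkin a b n k.
Proof.
rewrite /Msubst M_motzkin rmorph_motzkin /=.
by rewrite !comp_mpolyXU.
Qed.

Lemma det_mx22 (R : comNzRingType) (a b c d : R) :
  \det (mx22 a b c d) = a * d - c * b.
Proof.
rewrite (expand_det_row _ ord0) !big_ord_recl big_ord0 /cofactor !det_mx11 !mxE /=.
by rewrite expr0 expr1; ring.
Qed.

Theorem theorem3p2 (n r m : nat) :
  (forall l : nat, (l <= m)%N ->
     \sum_(0 <= k < (N n m r l).+1)
        \det (mx22 (M n k)           (M m (k + l + 1))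
                   (M (n + r + 1) k) (M (m + r + 1) (k + l + 1)))
     = \sum_(0 <= i < r.+1) M (n + i) 0 * Msubst (m + r - i) l Y Y)
  /\
  \sum_(0 <= l < (m + r).+1) \sum_(0 <= k < (N n m r l).+1)
     \det (mx22 (M n k)           (M m (k + l + 1))
                (M (n + r + 1) k) (M (m + r + 1) (k + l + 1)))
  = \sum_(0 <= i < r.+1) M (n + i) 0 * Msubst (m + r - i) 0 (Y + 1) Y.
Proof.
(* Stated for every [l], as the outer sum of part (2) runs up to [m + r]. *)
have sumE l : \sum_(0 <= k < (N n m r l).+1)
        \det (mx22 (M n k)           (M m (k + l + 1))
                   (M (n + r + 1) k) (M (m + r + 1) (k + l + 1)))
     = \sum_(0 <= i < r.+1) M (n + i) 0 * Msubst (m + r - i) l Y Y.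
  under eq_bigr => k _ do rewrite det_mx22 !M_motzkin.
  under [RHS]eq_bigr => i _ do rewrite M_motzkin Msubst_motzkin.
  (* The two values of the minimum in [N] correspond to the two alternatives of the hypothesis. *)
  by apply: sum_motzkin_det; rewrite /N; lia.
split=> [l _ //|].
under eq_bigr => l _ do rewrite sumE.
rewrite exchange_big_nat /=; apply: eq_bigr => i _.
rewrite -mulr_sumr; congr (_ * _).
under eq_bigr => l _ do rewrite Msubst_motzkin.
(* The range [l <= m + r] contains every height reachable in [m + r - i] steps. *)
by rewrite Msubst_motzkin sum_motzkin_diag //; lia.
Qed.
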